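(* Let $n\ge1$, $r,z\ge 0$ be integers with $k:=n-r-z\ge 1$, and let $\mathcal{D}\subset\{n-r,n-r+1,\dots,n\}$ with $n-r\in\mathcal{D}$. Let $q>n$ be any prime power. Then the polynomial encoding scheme with parameters $n,r,z,\mathcal{D},q$ described in the context is a rate-optimal $(n,k,r,z)_{\mathcal{Q}}$ secret sharing scheme with $\mathcal{Q}=\mathbb{F}_q^b$, and this single scheme achieves the optimal decoding bandwidth when $d$ nodes participate in decoding, universally for all $d\in\mathcal{D}$.
   Context: Notation: $[n]=\{1,\dots,n\}$; $\bm{c}_I=(c_i)_{i\in I}$; $H$ is Shannon entropy, all logarithms are to base $Q=|\mathcal{Q}|$. An $(n,k,r,z)_{\mathcal{Q}}$ secret sharing scheme consists of a randomized encoding function $F$ mapping a secret $\bm{m}\in\mathcal{Q}^k$ (uniformly distributed, independent of the internal randomness of $F$) to shares $\bm{c}=(c_1,\dots,c_n)\in\mathcal{Q}^n$ such that (Reliability) $H(\bm{m}\mid\bm{c}_I)=0$ for all $I\subset[n]$, $|I|=n-r$, and (Secrecy) $H(\bm{m}\mid\bm{c}_I)=H(\bm{m})$ for all $I\subset[n]$, $|I|=z$. It is rate-optimal if $k=n-r-z$ (the largest possible value of $k$). Optimal decoding bandwidth: for $I\subset[n]$ with $|I|\ge n-r$, preprocessing functions are maps $E_{I,i}:\mathcal{Q}\to\mathcal{S}_{I,i}$ ($i\in I$, $|\mathcal{S}_{I,i}|\le|\mathcal{Q}|$) and a decoding function is a map $D_I:\prod_{i\in I}\mathcal{S}_{I,i}\to\mathcal{Q}^k$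 with $D_I\big((E_{I,i}(c_i))_{i\in I}\big)=\bm{m}$ always. The communication overhead is $\mathrm{CO}(I)=\sum_{i\in I}\log|\mathcal{S}_{I,i}|-k$ and the decoding bandwidth is $\mathrm{CO}(I)+k$. For every scheme $\mathrm{CO}(I)\ge kz/(|I|-z)$; the scheme achieves the optimal decoding bandwidth when $d$ nodes participate if for every $I\subset[n]$ with $|I|=d$ there are preprocessing and decoding functions with $\mathrm{CO}(I)=\frac{kz}{d-z}$. The encoding scheme. Let $M$ be the least common multiple of $\{d-z:d\in\mathcal{D}\}$, and $b=M/k$ (an integer since $n-r\in\mathcal{D}$). The secret is a vector $\bm{m}\in\mathbb{F}_q^{M}=\mathbb{F}_q^{kb}$, identified with an element of $\mathcal{Q}^k$, $\mathcal{Q}=\mathbb{F}_q^b$. Write $\mathcal{D}=\{d_1>d_2>\dots>d_{|\mathcal{D}|}=n-r\}$ and set $p_1=\frac{M}{d_1-z}$ and $p_i=\frac{M}{d_i-z}-\frac{M}{d_{i-1}-z}$ for $1<i\le|\mathcal{D}|$. For each $i$ construct $p_i$ polynomials over $\mathbb{F}_q$ of (formal) degree $d_i-1$, i.e. each with $d_i$ coefficients, in degrees $0,\dots,d_i-1$. In every polynomial the $z$ lowest-degree coefficients (degrees $0,\dots,z-1$) are keys; all keys of all polynomials are i.i.d. uniform on $\mathbb{F}_q$ and independent of $\bm{m}$. The remaining $d_i-z$ coefficients (non-key coefficients) are defined recursively: for $i=1$, the $p_1(d_1-z)=M$ non-key coefficients of the $p_1$ polynomials of degree $d_1-1$ are the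 $M$ message symbols (via any bijection). For $i>1$, the $p_i(d_i-z)$ non-key coefficients of the $p_i$ polynomials of degree $d_i-1$ are, via any fixed bijection, the coefficients of degrees $d_i,d_i+1,\dots,d_{i-1}-1$ of all the $\sum_{j<i}p_j=\frac{M}{d_{i-1}-z}$ previously defined polynomials (those of degree higher than $d_i-1$); the two counts agree. In total there are $\sum_i p_i=b$ polynomials. For each polynomial fix $n$ distinct non-zero points of $\mathbb{F}_q$, one per node; node $v\in[n]$ stores, for each polynomial, its evaluation at the $v$-th point, so its share $c_v$ lies in $\mathbb{F}_q^b=\mathcal{Q}$. *)

(* Defs.v *)
From mathcomp Require Import all_boot all_order all_algebra finmap.
From mathcomp Require Import reals exp.

Set Implicit Arguments.
Unset Strict Implicit.
Unset Printing Implicit Defensive.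

Import Order.TTheory GRing.Theory Num.Theory.
Local Open Scope ring_scope.

Section FiniteProbability.
Variables (R : realType) (Omega : finType).
Implicit Types P : Omega -> R.

Definition is_distribution P : Prop :=
  (forall w, 0 <= P w) /\ \sum_w P w = 1.

Definition uniform (T : finType) : T -> R := fun=> #|T|%:R^-1.

Definition law P (T : finType) (X : Omega -> T) (x : T) : R :=
  \sum_(w | X w == x) P w.

Definition logb (B : nat) (x : R) : R := ln x / ln B%:R.

(* The convention 0 log 0 = 0 holds because of the factor 0. *)
Definition entropy (B : nat) P (T : finType) (X : Omega -> T) : R :=
  - \sum_x law P X x * logb B (law P X x).

(* H(X | Y) = - sum_(x, y) p(x, y) log p(x | y); the terms with p(y) = 0 vanish
   because then p(x, y) = 0. *)
Definition cond_entropy (B : nat) P (T U : finType)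
    (X : Omega -> T) (Y : Omega -> U) : R :=
  - \sum_x \sum_y
      law P (fun w => (X w, Y w)) (x, y) *
      logb B (law P (fun w => (X w, Y w)) (x, y) / law P Y y).

End FiniteProbability.

Section SecretSharing.
Variables (R : realType) (Q : finType) (n k : nat).
(* The internal randomness is a finite probability space (Omega, P). *)
Variables (Omega : finType) (P : Omega -> R).
Variable enc : {ffun 'I_k -> Q} -> Omega -> {ffun 'I_n -> Q}.

(* Uniform secret, independent of the internal randomness. *)
Definition joint (x : {ffun 'I_k -> Q} * Omega) : R :=
  uniform R x.1 * P x.2.

Definition secret (x : {ffun 'I_k -> Q} * Omega) : {ffun 'I_k -> Q} := x.1.

Definition shares (I : {set 'I_n}) (x : {ffun 'I_k -> Q} * Omega) :
    {ffun {v : 'I_n | v \in I} -> Q} :=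
  [ffun v => enc x.1 x.2 (val v)].

Definition reliable (r : nat) : Prop :=
  forall I : {set 'I_n}, #|I| = (n - r)%N ->
    cond_entropy #|Q| joint secret (shares I) = 0.

Definition secure (z : nat) : Prop :=
  forall I : {set 'I_n}, #|I| = z ->
    cond_entropy #|Q| joint secret (shares I) = entropy #|Q| joint secret.

Definition secret_sharing_scheme (r z : nat) : Prop :=
  [/\ is_distribution P, reliable r & secure z].

(* k = n - r - z, written without truncated subtraction. *)
Definition rate_optimal_scheme (r z : nat) : Prop :=
  secret_sharing_scheme r z /\ (k + r + z = n)%N.

Definition decodes_from (I : {set 'I_n}) (S : {v : 'I_n | v \in I} -> finType)
    (E : forall v, Q -> S v) (D : (forall v, S v) -> {ffun 'I_k -> Q}) : Prop :=
  forall m w, D (fun v => E v (enc m w (val v))) = m.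

Definition comm_overhead (I : {set 'I_n})
    (S : {v : 'I_n | v \in I} -> finType) : R :=
  \sum_v logb #|Q| #|S v|%:R - k%:R.

Definition optimal_decoding_bandwidth (z d : nat) : Prop :=
  forall I : {set 'I_n}, #|I| = d ->
    exists (S : {v : 'I_n | v \in I} -> finType)
           (E : forall v, Q -> S v) (D : (forall v, S v) -> {ffun 'I_k -> Q}),
      [/\ forall v, (#|S v| <= #|Q|)%N,
          decodes_from E D
        & comm_overhead S = k%:R * z%:R / (d%:R - z%:R)].

End SecretSharing.

(* Layers are numbered from 0: layer i consists of the polynomials of formal
   degree d_(i+1) - 1, where d_1 > d_2 > ... are the elements of D.
   The b polynomials are numbered 0, ..., b - 1, layer after layer. *)
Section Layers.
Variables (n r z : nat) (D : {fset nat}).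

Definition secret_size : nat := (n - r - z)%N.

(* The number M. *)
Definition block_lcm : nat := \big[lcmn/1%N]_(d <- D) (d - z)%N.

(* The number b = M / k of field symbols per share. *)
Definition subpack : nat := (block_lcm %/ secret_size)%N.

Definition deg (i : nat) : nat := nth 0%N (sort geq D) i.

Definition num_poly (i : nat) : nat :=
  (if i is i'.+1 then block_lcm %/ (deg i - z) - block_lcm %/ (deg i' - z)
   else block_lcm %/ (deg 0 - z))%N.

Definition layer (u : nat) : nat :=
  find (fun i => u < \sum_(j < i.+1) num_poly j)%N (iota 0 #|` D|).

(* A position (u, t) stands for the coefficient of degree t in polynomial u. *)
Definition nonkey (i : nat) : {set 'I_subpack * 'I_n} :=
  [set x : 'I_subpack * 'I_n | (layer x.1 == i) && (z <= x.2 < deg i)%N].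

(* For i > 0: the coefficients of degrees d_(i+1), ..., d_i - 1 of the
   polynomials of the layers before i. *)
Definition excess (i : nat) : {set 'I_subpack * 'I_n} :=
  [set x : 'I_subpack * 'I_n |
    (layer x.1 < i)%N && (deg i <= x.2 < deg i.-1)%N].

Definition bijects (T U : finType) (f : T -> U) (A : {set T}) (B : {set U}) :
    Prop := {in A &, injective f} /\ f @: A = B.

(* phi places the M = k * b message symbols in layer 0. *)
Definition message_bijection
    (phi : 'I_subpack * 'I_n -> 'I_secret_size * 'I_subpack) : Prop :=
  bijects phi (nonkey 0) [set: 'I_secret_size * 'I_subpack].

(* The sets nonkey i are pairwise disjoint, so that a single function psi
   encodes one arbitrary bijection for each layer i > 0. *)
Definition layer_bijections
    (psi : 'I_subpack * 'I_n -> 'I_subpack * 'I_n) : Prop :=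
  forall i, (0 < i < #|` D|)%N -> bijects psi (nonkey i) (excess i).

Definition evaluation_points (F : finFieldType)
    (alpha : 'I_subpack -> 'I_n -> F) : Prop :=
  forall u, injective (alpha u) /\ forall v, alpha u v != 0.

End Layers.

Section Encoding.
Variables (n r z : nat) (D : {fset nat}) (F : finFieldType).
Local Notation k := (secret_size n r z).
Local Notation b := (subpack n r z D).

Definition symbol : finType := {ffun 'I_b -> F}.

(* One key for each degree t < z of each polynomial; the uniform distribution
   on this type makes the keys independent and uniform on F. *)
Definition keys : finType := {ffun 'I_b * 'I_z -> F}.

Variables (phi : 'I_b * 'I_n -> 'I_k * 'I_b) (psi : 'I_b * 'I_n -> 'I_b * 'I_n).
Variable alpha : 'I_b -> 'I_n -> F.
Variables (m : {ffun 'I_k -> symbol}) (w : keys).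

Definition key_or (x : 'I_b * 'I_n) (c : F) : F :=
  if insub (val x.2) is Some t then w (x.1, t) else c.

(* Coefficients of the polynomials of the layers 0, ..., i; meaningful at the
   positions (u, t) with layer u <= i and t < deg (layer u). *)
Fixpoint coef_upto (i : nat) (x : 'I_b * 'I_n) : F :=
  if i is i'.+1 then
    if (layer z D x.1 <= i')%N then coef_upto i' x
    else key_or x (coef_upto i' (psi x))
  else key_or x (m (phi x).1 (phi x).2).

Definition encoding_poly (u : 'I_b) : {poly F} :=
  \sum_(t < n | (t < deg D (layer z D u))%N)
    coef_upto (layer z D u) (u, t) *: 'X^t.

Definition poly_encoding : {ffun 'I_n -> symbol} :=
  [ffun v => [ffun u => (encoding_poly u).[alpha u v]]].

End Encoding.

(* Main.v *)
(* Every non-key coefficient is, by tracing the bijections psi down to layer 0,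
   a message symbol: the copied coefficients have degree at least n - r > z, so
   they are never keys.  Hence for a fixed message the shares of z nodes are an
   injective function of the keys (two key vectors with equal shares give
   polynomials differing by one of size at most z with z roots), thus bijective
   by counting, so uniform whatever the message: this is secrecy.

   When d = deg i nodes participate, each sends its evaluations of the
   polynomials of the layers 0, ..., i, that is M / (d - z) field symbols.
   Going down from layer i to layer 0, the coefficients of degree at least
   deg i of a polynomial have been copied into later, already known, layers; the
   d evaluations then determine the remaining ones.  Layer 0 contains the
   message.  Reliability is the case d = n - r. *)
Require Import Defs.
From mathcomp Require Import all_boot all_order all_algebra finmap.
From mathcomp Require Import reals exp.
From mathcomp Require Import zify ring.

Set Implicit Arguments.
Unset Strict Implicit.
Unset Printing Implicit Defensive.

Import Order.TTheory GRing.Theory Num.Theory.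

(** * Conditional entropy of determined and of independent variables *)

Section Entropy.
Local Open Scope ring_scope.
Variables (R : realType) (Omega : finType) (P : Omega -> R) (B : nat).
Variables (T U : finType) (X : Omega -> T) (Y : Omega -> U).

Lemma logb1 : logb B 1 = 0 :> R.
Proof. by rewrite /logb ln1 mul0r. Qed.

(** Unit of bandwidth: over an alphabet of words of [c] field symbols, sending [e] field symbols
    costs [e / c]. *)
Lemma logb_expn (q e c : nat) : (1 < q)%N -> (0 < c)%N ->
  logb (q ^ c) (q ^ e)%:R = e%:R / c%:R :> R.
Proof.
move=> q1 c0; have q0 : 0 < q%:R :> R by rewrite ltr0n ltnW.
have lnq : ln q%:R != 0 :> R by rewrite gt_eqF // ln_gt0 // ltr1n.
rewrite /logb !natrX !lnXn // -!(mulr_natl (ln _)).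
by field; rewrite lnq pnatr_eq0 -lt0n c0.
Qed.

Lemma sum_law (V : finType) (Z : Omega -> V) :
  \sum_v law P Z v = \sum_w P w.
Proof. by rewrite [RHS](partition_big Z predT). Qed.

(** If some outcome gives [(x, y)], the event [Y = y] lies inside [X = x], so the conditional
    probability is 1, unless [y] has mass zero and the factor in front vanishes. *)
Lemma cond_entropy_determined :
  (forall w w', Y w = Y w' -> X w = X w') -> cond_entropy B P X Y = 0.
Proof.
move=> YX; rewrite /cond_entropy big1 ?oppr0 // => x _; rewrite big1 // => y _.
have [w0 /eqP[X0 Y0]|none] := pickP (fun w => (X w, Y w) == (x, y)); last first.
  by rewrite /law big_pred0 ?mul0r.
have -> : law P (fun w => (X w, Y w)) (x, y) = law P Y y.
  apply: eq_bigl => w; rewrite xpair_eqE andb_idl // => /eqP Yw.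
  by rewrite -X0 (YX w w0) ?Y0.
have [->|Py] := eqVneq (law P Y y) 0; first by rewrite mul0r.
by rewrite divff // logb1 mulr0.
Qed.

Lemma cond_entropy_independent :
  \sum_w P w = 1 ->
  (forall x y, law P (fun w => (X w, Y w)) (x, y) = law P X x * law P Y y) ->
  cond_entropy B P X Y = entropy B P X.
Proof.
move=> P1 indep; rewrite /cond_entropy /entropy; congr (- _).
apply: eq_bigr => x _.
rewrite (eq_bigr (fun y => law P Y y * (law P X x * logb B (law P X x)))).
  rewrite -mulr_suml (_ : \sum_y law P Y y = 1) ?mul1r //.
  by rewrite sum_law.
move=> y _; rewrite indep.
have [->|Py] := eqVneq (law P Y y) 0; first by rewrite mulr0 !mul0r.
by rewrite mulfK // -mulrA mulrCA.
Qed.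

End Entropy.

(** * Secrecy, reliability and decoding reduced to properties of an arbitrary encoder *)

Section SecretSharing.
Local Open Scope ring_scope.
Variables (R : realType) (Q : finType) (n k : nat) (Omega : finType).
Variables (P : Omega -> R) (enc : {ffun 'I_k -> Q} -> Omega -> {ffun 'I_n -> Q}).
Hypothesis P1 : \sum_w P w = 1.

Lemma law_joint (V : finType) (Z : {ffun 'I_k -> Q} * Omega -> V) v :
  law (joint (Q := Q) (k := k) P) Z v =
  \sum_m uniform R m * law P (fun w => Z (m, w)) v.
Proof.
rewrite /law /joint.
under [RHS]eq_bigr do rewrite big_distrr /=.
by rewrite pair_big_dep; apply: eq_big => [[m w]|[m w] _].
Qed.

Lemma law_joint_secret (m : {ffun 'I_k -> Q}) :
  law (joint P) (@secret Q k Omega) m = uniform R m.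
Proof.
rewrite law_joint (bigD1 m) //= big1 ?addr0 => [|m' m'm].
  by rewrite /law /secret /= eqxx P1 mulr1.
by rewrite /law /secret /= (negbTE m'm) big_pred0_eq mulr0.
Qed.

Lemma sum_uniform (T : finType) : (0 < #|T|)%N -> \sum_(x : T) uniform R x = 1.
Proof.
move=> T0; rewrite /uniform sumr_const -[_ *+ _]mulr_natr mulVf //.
by rewrite pnatr_eq0 -lt0n.
Qed.

Lemma sum_joint : (0 < #|{ffun 'I_k -> Q}|)%N ->
  \sum_x joint (Q := Q) (k := k) P x = 1.
Proof.
move=> N0; rewrite -(sum_law (joint P) (@secret Q k Omega)) -(sum_uniform N0).
by apply: eq_bigr => m _; rewrite law_joint_secret.
Qed.

(** Since [mu] does not depend on [m], the shares have the same law under every message, hence are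
    independent of the secret. *)
Lemma secret_independent_shares (I : {set 'I_n}) mu :
  (0 < #|{ffun 'I_k -> Q}|)%N ->
  (forall m y, law P (fun w => shares enc I (m, w)) y = mu y) ->
  cond_entropy #|Q| (joint P) (@secret Q k Omega) (shares enc I) =
  entropy #|Q| (joint P) (@secret Q k Omega).
Proof.
move=> N0 lawE; apply: cond_entropy_independent; first exact: sum_joint.
move=> m y; rewrite law_joint_secret.
have -> : law (joint P) (shares enc I) y = mu y.
  rewrite law_joint; under eq_bigr do rewrite lawE.
  by rewrite -mulr_suml sum_uniform // mul1r.
rewrite law_joint (bigD1 m) //= big1 ?addr0 => [|m' m'm].
  rewrite -(lawE m); congr (_ * _); apply: eq_bigl => w.
  by rewrite xpair_eqE /secret /= eqxx.
rewrite /law big_pred0 ?mulr0 // => w.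
by rewrite xpair_eqE /secret /= (negbTE m'm).
Qed.

Lemma secret_determined_by_shares (I : {set 'I_n}) :
  (forall m m' w w', {in I, enc m w =1 enc m' w'} -> m = m') ->
  cond_entropy #|Q| (joint P) (@secret Q k Omega) (shares enc I) = 0.
Proof.
move=> encI; apply: cond_entropy_determined => -[m w] [m' w'] /ffunP sE.
apply: (encI _ _ w w') => v vI.
by have := sE (Sub v vI); rewrite !ffunE.
Qed.

(** The decoder picks any message consistent with the received data for some randomness; [m0] is
    returned only on data that no encoding produces. *)
Lemma decoder_exists (I : {set 'I_n}) (S : {v : 'I_n | v \in I} -> finType)
    (E : forall v, Q -> S v) (m0 : {ffun 'I_k -> Q}) :
  (forall m m' w w', (forall v, E v (enc m w (val v)) = E v (enc m' w' (val v)))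
     -> m = m') ->
  exists D, decodes_from enc E D.
Proof.
move=> Einj.
exists (fun f => odflt m0
  [pick m | [exists w, [forall v, E v (enc m w (val v)) == f v]]]).
move=> m w; case: pickP => [m' /existsP[w' /forallP Ew]|/(_ m)/existsP[]] /=.
  by apply: Einj => v; apply/eqP/Ew.
by exists w; apply/forallP.
Qed.

End SecretSharing.

(** The tail condition bounds the size of [p - q] by [#|I|], and [#|I|] distinct roots then force it
    to vanish. Agreement of the high coefficients thus replaces a degree bound. *)
Lemma polynomial_interpolation_unique (F : idomainType) (T : finType)
    (I : {set T}) (a : T -> F) (p q : {poly F}) :
  injective a -> {in I, forall v, p.[a v] = q.[a v]}%R ->
  (forall s, #|I| <= s -> (p`_s = q`_s)%R) -> p = q.
Proof.
move=> a_inj pq tail; apply/eqP; rewrite -GRing.subr_eq0; apply: contraT => nz.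
have : all (root (p - q)%R) [seq a v | v <- enum I].
  apply/allP => _ /mapP[v vI ->]; rewrite mem_enum in vI.
  by rewrite rootE !hornerE pq // GRing.subrr.
move=> /(max_poly_roots nz); rewrite map_inj_uniq // enum_uniq.
move=> /(_ isT); rewrite size_map -cardE ltnNge => /negP[].
by apply/leq_sizeP => s /tail sE; rewrite coefB sE GRing.subrr.
Qed.

(** * Degrees and numbering of the layers *)

Section Layers.
Variables (n r z : nat) (D : {fset nat}).
Local Notation k := (secret_size n r z).
Local Notation M := (block_lcm z D).
Local Notation b := (subpack n r z D).
Local Notation L := #|` D|.
Hypothesis k_gt0 : 0 < k.
Hypothesis D_bounds : forall d, d \in D -> n - r <= d <= n.
Hypothesis nr_in_D : n - r \in D.

Lemma deg_mem i : i < L -> deg D i \in D.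
Proof.
move=> iL; have : deg D i \in sort geq D by rewrite mem_nth ?size_sort.
by rewrite mem_sort.
Qed.

Lemma deg_index d : d \in D -> exists2 i, i < L & deg D i = d.
Proof.
move=> dD; exists (index d (sort geq D)).
  by rewrite -(size_sort geq) index_mem mem_sort.
by rewrite /deg nth_index // mem_sort.
Qed.

Lemma deg_antimono i j : i <= j -> j < L -> deg D j <= deg D i.
Proof.
move=> ij jL; have geq_trans : transitive geq by move=> a c e /=; lia.
have geq_total : total geq by move=> a c; rewrite /geq; lia.
apply: (sorted_leq_nth geq_trans _ _ (sort_sorted geq_total D)) => //=.
- by move=> a; exact: leqnn.
- by rewrite inE size_sort (leq_ltn_trans ij jL).
- by rewrite inE size_sort.
Qed.

Lemma deg_gt_z i : i < L -> z < deg D i.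
Proof.
by move=> /deg_mem/D_bounds; move: k_gt0; rewrite /secret_size; lia.
Qed.

Lemma deg_le_n i : i < L -> deg D i <= n.
Proof. by move=> /deg_mem/D_bounds/andP[]. Qed.

Lemma deg_last : deg D L.-1 = n - r.
Proof.
have [i iL deg_i] := deg_index nr_in_D.
have lastL : L.-1 < L by lia.
have := deg_antimono (_ : i <= L.-1) lastL.
by have := D_bounds (deg_mem lastL); lia.
Qed.

Lemma L_gt0 : 0 < L.
Proof. by have [i] := deg_index nr_in_D; lia. Qed.

Lemma block_lcm_gt0 : 0 < M.
Proof.
rewrite /block_lcm big_seq_cond; elim/big_ind: _ => // [x y x0 y0|d].
  by rewrite lcmn_gt0 x0.
by rewrite andbT => /D_bounds; move: k_gt0; rewrite /secret_size; lia.
Qed.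

Lemma dvdn_block_lcm d : d \in D -> d - z %| M.
Proof. by move=> dD; rewrite /block_lcm (big_rem d) //= dvdn_lcml. Qed.

Lemma subpack_mul : b * k = M.
Proof. by rewrite divnK // /secret_size dvdn_block_lcm. Qed.

Lemma subpack_gt0 : 0 < b.
Proof. by move: block_lcm_gt0; rewrite -subpack_mul; case: (b). Qed.

(** The sum telescopes; truncated subtraction is exact because the degrees decrease and stay above
    [z]. *)
Lemma sum_num_poly i : i < L ->
  \sum_(j < i.+1) num_poly z D j = M %/ (deg D i - z).
Proof.
elim: i => [|i IHi] iL; first by rewrite big_ord1.
rewrite big_ord_recr /= IHi ?(ltnW iL) // subnKC // leq_div2l //.
  have := deg_gt_z iL; lia.
by have := deg_antimono (leqnSn i) iL; lia.
Qed.

(** The last degree is [n - r], so all layers together hold [b] polynomials and [find] succeeds. *)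
Lemma layer_lt (u : 'I_b) : layer z D u < L.
Proof.
rewrite -[X in _ < X](size_iota 0) -has_find; apply/hasP; exists L.-1.
  by rewrite mem_iota add0n ltn_predL L_gt0.
by rewrite sum_num_poly ?deg_last ?ltn_predL ?L_gt0.
Qed.

(** Numbering layer after layer makes the layers up to [i] an initial segment of the polynomials;
    this lets a node send a prefix of its share. *)
Lemma layer_leE (u : 'I_b) i : i < L ->
  (layer z D u <= i) = (u < M %/ (deg D i - z)).
Proof.
move=> iL; rewrite -sum_num_poly //; apply/idP/idP => [ui|].
  have := layer_lt u; rewrite -{1}[X in _ < X](size_iota 0) -has_find.
  move/(nth_find 0); rewrite nth_iota ?layer_lt // add0n => /leq_trans; apply.
  rewrite -!(big_mkord predT (num_poly z D))
          [leqRHS](@big_cat_nat _ _ _ (layer z D u).+1) //=.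
  exact: leq_addr.
apply: contraTT; rewrite -!ltnNge => ui.
have := before_find 0 ui; rewrite nth_iota // add0n.
by move=> /negbT; rewrite -leqNgt.
Qed.


(** * Coefficients of the encoding polynomials *)

Section Encoding.
Local Open Scope ring_scope.
Variables (F : finFieldType).
Variables (phi : 'I_b * 'I_n -> 'I_k * 'I_b) (psi : 'I_b * 'I_n -> 'I_b * 'I_n).
Variable alpha : 'I_b -> 'I_n -> F.
Hypothesis phi_bij : message_bijection phi.
Hypothesis psi_bij : layer_bijections psi.
Hypothesis alpha_inj : forall u, injective (alpha u).
Local Notation sym := (symbol n r z D F).
Implicit Types (m : {ffun 'I_k -> sym}) (w : keys n r z D F).
Implicit Types (x : 'I_b * 'I_n) (u : 'I_b) (t : 'I_n).

(** The stage equal to the layer of [x] is where this coefficient gets its final value; later stages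
    leave it unchanged. *)
Definition coef m w x : F := coef_upto phi psi m w (layer z D x.1) x.

Lemma coef_upto_layer m w i x :
  (layer z D x.1 <= i)%N -> coef_upto phi psi m w i x = coef m w x.
Proof.
elim: i => [|i IHi]; first by rewrite /coef leqn0 => /eqP->.
rewrite leq_eqVlt ltnS => /predU1P[xi|xi]; first by rewrite /coef xi.
by rewrite /= xi IHi.
Qed.

Lemma coef_key m w x (tz : (x.2 < z)%N) : coef m w x = w (x.1, Ordinal tz).
Proof.
have keyE c : key_or w x c = w (x.1, Ordinal tz) by rewrite /key_or insubT.
by rewrite /coef; case xl: (layer z D x.1) => [|i] /=; rewrite ?xl ?ltnn keyE.
Qed.

Lemma key_or_nonkey w x c : (z <= x.2)%N -> key_or w x c = c.
Proof. by move=> zx; rewrite /key_or insubF // ltnNge zx. Qed.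

Lemma coef_message m w x : x \in nonkey n r z D 0 ->
  coef m w x = m (phi x).1 (phi x).2.
Proof.
by rewrite inE /coef => /andP[/eqP-> /andP[zx _]] /=; rewrite key_or_nonkey.
Qed.

Lemma psi_excess x :
  (0 < layer z D x.1)%N -> x \in nonkey n r z D (layer z D x.1) ->
  psi x \in excess n r z D (layer z D x.1).
Proof.
move=> i0 xi; have iL : (0 < layer z D x.1 < L)%N by rewrite i0 layer_lt.
by have [_ <-] := psi_bij iL; exact: imset_f.
Qed.

(** The recursion of the scheme freed of the stage index: [psi x] lies in an earlier layer, where
    the previous stage already agrees with [coef]. *)
Lemma coef_psi m w x :
  (0 < layer z D x.1)%N -> x \in nonkey n r z D (layer z D x.1) ->
  coef m w x = coef m w (psi x).
Proof.
move=> i0 xi; have := psi_excess i0 xi; move: xi i0; rewrite !inE eqxx /= /coef.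
case xl: (layer z D x.1) => [//|i] /andP[zx _] _ /andP[pi _] /=.
by rewrite xl ltnn key_or_nonkey // coef_upto_layer.
Qed.

Lemma coef_nonkey_keyless m w w' x : (z <= x.2 < deg D (layer z D x.1))%N ->
  coef m w x = coef m w' x.
Proof.
move: {2}(layer z D x.1).+1 (ltnSn (layer z D x.1)) => j.
elim: j x => // j IHj x xj zx.
have xi : x \in nonkey n r z D (layer z D x.1) by rewrite inE eqxx.
have [x0|x0] := posnP (layer z D x.1).
  by rewrite x0 in xi; rewrite !coef_message.
rewrite (coef_psi m w x0 xi) (coef_psi m w' x0 xi); have := psi_excess x0 xi.
rewrite inE => /andP[pi /andP[pt pt']]; apply: IHj; first by lia.
(* [psi x] is again a non-key position: its exponent is at least the [deg] of the layer of [x],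
   hence above [z], and below the [deg] of the preceding layer, hence below that of its own. *)
rewrite (leq_trans (ltnW (deg_gt_z (layer_lt x.1))) pt) /=.
apply: leq_trans pt' (deg_antimono _ _); last first.
  by apply: leq_ltn_trans (leq_pred _) (layer_lt _).
by lia.
Qed.

Local Notation poly m w u := (encoding_poly phi psi m w u).

Lemma coef_encoding_poly m w u t : (t < deg D (layer z D u))%N ->
  (poly m w u)`_t = coef m w (u, t).
Proof.
move=> tu; rewrite /encoding_poly coef_sum (bigD1 t) //= coefZ coefXn eqxx mulr1.
rewrite big1 ?addr0 // => s /andP[_ st]; rewrite coefZ coefXn.
by rewrite (inj_eq val_inj) eq_sym (negbTE st) mulr0.
Qed.

Lemma size_encoding_poly m w u :
  (size (poly m w u) <= deg D (layer z D u))%N.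
Proof.
apply/leq_sizeP => s us; rewrite /encoding_poly coef_sum big1 // => t tu.
rewrite coefZ coefXn; case: eqP => [st|_]; last by rewrite mulr0.
by rewrite -st ltnNge us in tu.
Qed.

Lemma coef_eq_encoding_poly m m' w w' u :
  poly m w u = poly m' w' u -> forall t, (t < deg D (layer z D u))%N ->
  coef m w (u, t) = coef m' w' (u, t).
Proof. by move=> pq t tu; rewrite -!coef_encoding_poly ?pq. Qed.

Lemma encoding_poly_tail m m' w w' u d :
  (forall t, (d <= t < deg D (layer z D u))%N ->
     coef m w (u, t) = coef m' w' (u, t)) ->
  forall s, (d <= s)%N -> (poly m w u)`_s = (poly m' w' u)`_s.
Proof.
move=> tailE s ds; have [su|us] := ltnP s (deg D (layer z D u)); last first.
  by rewrite !nth_default // (leq_trans (size_encoding_poly _ _ _)).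
have sn : (s < n)%N := leq_trans su (deg_le_n (layer_lt u)).
by rewrite !(@coef_encoding_poly _ _ _ (Ordinal sn)) // tailE //= ds.
Qed.

(** * Secrecy: uniformity of any [z] shares *)

Lemma shares_inj_keys m (I : {set 'I_n}) : #|I| = z ->
  injective (fun w => shares (poly_encoding phi psi alpha) I (m, w)).
Proof.
move=> Iz w w' /ffunP wE; apply/ffunP => -[u t].
have pE : poly m w u = poly m w' u.
  apply: (polynomial_interpolation_unique (I := I) (@alpha_inj u)) => [v vI|].
    by have := wE (Sub v vI); rewrite !ffunE /= => /ffunP/(_ u); rewrite !ffunE.
  (* From degree [z] on, both polynomials have the coefficients dictated by the common message
     [m]. *)
  rewrite Iz; apply: encoding_poly_tail => s su.
  exact: coef_nonkey_keyless.
have tu : (t < deg D (layer z D u))%N.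
  exact: ltn_trans (ltn_ord t) (deg_gt_z (layer_lt u)).
have tn : (t < n)%N := leq_trans tu (deg_le_n (layer_lt u)).
have := coef_eq_encoding_poly pE (t := Ordinal tn) tu.
rewrite !(@coef_key _ _ (u, Ordinal tn) (ltn_ord t)) /=.
by rewrite (_ : Ordinal (ltn_ord t) = t) //; apply: val_inj.
Qed.

Lemma law_shares (R : realType) m (I : {set 'I_n}) y : #|I| = z ->
  law (@uniform R (keys n r z D F))
      (fun w => shares (poly_encoding phi psi alpha) I (m, w)) y =
  #|keys n r z D F|%:R^-1.
Proof.
move=> Iz; have [|g fK gK] := inj_card_bij (shares_inj_keys (m := m) Iz).
  (* Keys and tuples of [z] shares are equally many, [#|F| ^ (b * z)], so each tuple of shares comes
     from exactly one key vector. *)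
  by rewrite !card_ffun card_prod card_sig Iz !card_ord expnM.
rewrite /law (big_pred1 (g y)) // => w /=.
by rewrite -(inj_eq (can_inj fK)) gK.
Qed.

Lemma secure_encoding (R : realType) :
  secure (@uniform R (keys n r z D F)) (poly_encoding phi psi alpha) z.
Proof.
move=> I Iz; apply: secret_independent_shares => [||m y].
- apply: sum_uniform; apply/card_gt0P; by exists [ffun=> 0].
- by apply/card_gt0P; exists [ffun=> [ffun=> 0]].
- exact: law_shares.
Qed.

(** * Decoding from the participating nodes *)

Lemma excess_cover (i : nat) u t :
  (i < L)%N -> (deg D i <= t < deg D (layer z D u))%N ->
  exists2 l, (layer z D u < l <= i)%N & (u, t) \in excess n r z D l.
Proof.
move=> iL /andP[it tu].
have exl : exists l, (deg D l <= t)%N by exists i.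
(* The first [l] with [deg D l <= t] is the layer into which [(u, t)] is copied; minimality gives
   [t < deg D l.-1]. *)
case: (ex_minnP exl) => l lt lmin.
have li : (l <= i)%N := lmin _ it.
have ul : (layer z D u < l)%N.
  rewrite ltnNge; apply/negP => lu.
  by have := deg_antimono lu (layer_lt u); lia.
exists l; first by rewrite ul.
rewrite inE /= ul lt /= ltnNge; apply/negP => /lmin.
by lia.
Qed.

Lemma decoding_upto m m' w w' (I : {set 'I_n}) i :
  (i < L)%N -> #|I| = deg D i ->
  (forall v u, v \in I -> (layer z D u <= i)%N ->
    poly_encoding phi psi alpha m w v u =
    poly_encoding phi psi alpha m' w' v u) ->
  forall u, (layer z D u <= i)%N -> poly m w u = poly m' w' u.
Proof.
(* Induction on [i - layer z D u]: a polynomial is decoded after those of the later layers up to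
   [i]. *)
move=> iL Ii cE u; move: {2}(i - layer z D u)%N.+1 (ltnSn (i - layer z D u)) => j.
elim: j u => // j IHj u uj ui.
apply: (polynomial_interpolation_unique (I := I) (@alpha_inj u)) => [v vI|].
  by have := cE v u vI ui; rewrite !ffunE.
rewrite Ii; apply: encoding_poly_tail => t tu.
have [l /andP[ul li] utl] := excess_cover iL tu.
have l0 : (0 < l < L)%N by lia.
have [_ psiE] := psi_bij l0.
(* Surjectivity of [psi] identifies this high coefficient with one in the later layer [l], known by
   induction. *)
have : (u, t) \in psi @: nonkey n r z D l by rewrite psiE.
case/imsetP => x xl ->; have := xl; rewrite inE => /andP[/eqP lx /andP[zx xd]].
rewrite -!coef_psi ?lx //; try lia.
case: x => x s in xl lx zx xd *.
apply: coef_eq_encoding_poly; last by rewrite lx.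
by apply: IHj => /=; rewrite lx; lia.
Qed.

(** Through [phi], every message symbol is a coefficient in layer 0, which is always among the
    decoded layers. *)
Lemma decoding_message m m' w w' (I : {set 'I_n}) i :
  (i < L)%N -> #|I| = deg D i ->
  (forall v u, v \in I -> (layer z D u <= i)%N ->
    poly_encoding phi psi alpha m w v u =
    poly_encoding phi psi alpha m' w' v u) ->
  m = m'.
Proof.
move=> iL Ii cE; apply/ffunP => a; apply/ffunP => c.
have [_ phiE] := phi_bij.
have : (a, c) \in phi @: nonkey n r z D 0 by rewrite phiE inE.
case/imsetP => -[u t] ut0 acE.
have := ut0; rewrite inE => /andP[/eqP /= u0 /andP[zt td]].
have := coef_message m w ut0; have := coef_message m' w' ut0.
rewrite -acE /= => <- <-; apply: coef_eq_encoding_poly; last by rewrite u0.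
by apply: (decoding_upto iL Ii cE); rewrite u0.
Qed.

Lemma reliable_encoding (R : realType) :
  reliable (@uniform R (keys n r z D F)) (poly_encoding phi psi alpha) r.
Proof.
move=> I Ir; have [i iL deg_i] := deg_index nr_in_D.
apply: secret_determined_by_shares => m m' w w' cE.
apply: (decoding_message iL (w := w) (w' := w') (I := I)); first by rewrite Ir.
by move=> v u vI _; rewrite cE.
Qed.

Lemma optimal_bandwidth_encoding (R : realType) d : d \in D ->
  optimal_decoding_bandwidth R (poly_encoding phi psi alpha) z d.
Proof.
move=> dD I Id; have [i iL deg_i] := deg_index dD.
(* The layers up to [i] hold [e] polynomials, so each node sends the first [e] symbols of its
   share. *)
pose e := (M %/ (d - z))%N.
have zd : (z < d)%N by rewrite -deg_i deg_gt_z.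
have eM : (e * (d - z) = b * k)%N by rewrite divnK ?dvdn_block_lcm // subpack_mul.
have eb : (e <= b)%N.
  by apply: leq_div2l => //; have := D_bounds dD; rewrite /secret_size; lia.
pose S (v : {v : 'I_n | v \in I}) : finType := {ffun 'I_e -> F}.
pose E v (c : sym) : S v := [ffun u => c (widen_ord eb u)].
have [|Dec decE] := @decoder_exists _ _ _ _ (poly_encoding phi psi alpha) I S E
  [ffun=> [ffun=> 0]].
  move=> m m' w w' cE; apply: (decoding_message iL (w := w) (w' := w') (I := I));
    first by rewrite deg_i.
  move=> v u vI; rewrite layer_leE // deg_i => ue.
  have ueE : widen_ord eb (Ordinal ue) = u by apply: val_inj.
  by have /ffunP/(_ (Ordinal ue)) := cE (Sub v vI);
    rewrite [LHS]ffunE [RHS]ffunE ueE.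
exists S, E, Dec; split=> // [v|].
  by rewrite !card_ffun !card_ord leq_pexp2l // ltnW // card_finRing_gt1.
rewrite /comm_overhead.
under eq_bigr do
  rewrite !card_ffun !card_ord logb_expn ?subpack_gt0 ?card_finRing_gt1 //.
rewrite sumr_const card_sig Id.
have dz : d%:R - z%:R != 0 :> R.
  by rewrite -natrB ?(ltnW zd) // pnatr_eq0 -lt0n subn_gt0.
have b0 : b%:R != 0 :> R by rewrite pnatr_eq0 -lt0n subpack_gt0.
(* Each node sends [k / (d - z)] share symbols; the total over [d] nodes exceeds [k] by
   [k * z / (d - z)]. *)
have eb_ratio : e%:R / b%:R = k%:R / (d%:R - z%:R) :> R.
  apply/eqP; rewrite eqr_div // -natrB ?(ltnW zd) // -!natrM eM mulnC //.
by rewrite -[_ *+ d]mulr_natr eb_ratio; field.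
Qed.

End Encoding.

End Layers.

Theorem theorem2 (R : realType) (n r z : nat) (D : {fset nat})
    (F : finFieldType)
    (hn : 1 <= n)
    (hk : 1 <= secret_size n r z)
    (hD : forall d, d \in D -> n - r <= d <= n)
    (hDmin : n - r \in D)
    (hF : n < #|F|)
    (phi : 'I_(subpack n r z D) * 'I_n ->
           'I_(secret_size n r z) * 'I_(subpack n r z D))
    (psi : 'I_(subpack n r z D) * 'I_n -> 'I_(subpack n r z D) * 'I_n)
    (alpha : 'I_(subpack n r z D) -> 'I_n -> F)
    (hphi : message_bijection phi)
    (hpsi : layer_bijections psi)
    (halpha : evaluation_points alpha) :
  rate_optimal_scheme (@uniform R (keys n r z D F))
    (poly_encoding phi psi alpha) r z /\
  forall d, d \in D ->
    optimal_decoding_bandwidth R (poly_encoding phi psi alpha) z d.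
Proof.
have alpha_inj u := proj1 (halpha u).
split; last by move=> d; apply: optimal_bandwidth_encoding.
(* Positivity in [hk] makes the truncated subtractions in [secret_size] exact. *)
split; last by move: hk; rewrite /secret_size; lia.
split; [split|exact: reliable_encoding|exact: secure_encoding].
  by move=> w; rewrite invr_ge0 ler0n.
by apply: sum_uniform; apply/card_gt0P; exists [ffun=> 0%R].
Qed.
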